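(* Let $\log_G:(G,\cdot)\to\mathfrak g$ and $\log_H:(H,\star)\to\mathfrak h$ be two log-Euclidean Lie groups of the same dimension, with inverse diffeomorphisms $\exp_G=\log_G^{-1}$ and $\exp_H=\log_H^{-1}$, and let $\psi:\mathfrak g\to\mathfrak h$ be any linear isomorphism. Then the map $\Phi:(G,\cdot)\to(H,\star)$ defined by $$\Phi:=\exp_H\circ\,\psi\circ\log_G$$ is the unique Lie group isomorphism $G\to H$ such that $\mathrm d_{e_G}\Phi=\psi$.
   Context: A log-Euclidean Lie group $\phi:G\to V$ is a smooth manifold $G$ with a diffeomorphism $\phi$ onto a finite-dimensional real vector space $V$, equipped with the commutative Lie group law $u\cdot v=\phi^{-1}(\phi(u)+\phi(v))$; the identity is $e_G=\phi^{-1}(0)$. The Lie algebra of $G$, i.e. $T_{e_G}G$, is identified with $V$ via $\mathrm d_{e_G}\phi$; one writes $\mathfrak g$ for $V$, $\log_G$ for $\phi$ and $\exp_G$ for $\phi^{-1}$ (which is the Lie exponential map). Under these identifications (for both groups), $\mathrm d_{e_G}\log_G=\mathrm{Id}_{\mathfrak g}$ and $\mathrm d_0\exp_H=\mathrm{Id}_{\mathfrak h}$, and $\mathrm d_{e_G}\Phi$ is regarded as a linear map $\mathfrak g\to\mathfrak h$. *)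

(* Defs.v *)
From HB Require Import structures.
From mathcomp Require Import all_boot all_order all_algebra.
From mathcomp Require Import all_classical all_reals all_analysis.

Set Implicit Arguments.
Unset Strict Implicit.
Unset Printing Implicit Defensive.

Import Order.TTheory GRing.Theory Num.Theory.
Import numFieldNormedType.Exports.
Import VectorInternalTheory.

Local Open Scope classical_set_scope.
Local Open Scope ring_scope.

(* Intended for open U and finite-dimensional V, where this is the usual notion
   of a C^k map: a continuous map for k = 0, and for k.+1 a differentiable map
   all of whose directional derivatives are C^k. *)
Fixpoint Ck_on (R : realType) (V W : normedModType R) (k : nat)
    (U : set V) (f : V -> W) : Prop :=
  if k is k'.+1 then
    (forall x, U x -> differentiable f x) /\ (forall v, Ck_on k' U ('D_v f))
  else {in U, continuous f}.

Definition smooth_on (R : realType) (V W : normedModType R)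
    (U : set V) (f : V -> W) : Prop := forall k, Ck_on k U f.

(* The two maps are total; only their restrictions to the open sets
   chart_dom and chart_cod matter, where they are inverse homeomorphisms. *)
Record chart (R : realType) (n : nat) (M : topologicalType) := Chart {
  chart_dom : set M;
  chart_cod : set 'rV[R]_n;
  chart_map :> M -> 'rV[R]_n;
  chart_inv : 'rV[R]_n -> M;
  chart_dom_open : open chart_dom;
  chart_cod_open : open chart_cod;
  chart_map_fun : set_fun chart_dom chart_cod chart_map;
  chart_inv_fun : set_fun chart_cod chart_dom chart_inv;
  chart_mapK : {in chart_dom, cancel chart_map chart_inv};
  chart_invK : {in chart_cod, cancel chart_inv chart_map};
  chart_map_continuous : {in chart_dom, continuous chart_map};
  chart_inv_continuous : {in chart_cod, continuous chart_inv} }.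

(* The atlas need not be maximal: it stands for the smooth structure that it
   generates, and the notions below depend on that structure only. *)
Record smoothManifold (R : realType) (n : nat) := SmoothManifold {
  manifold_space :> topologicalType;
  manifold_hausdorff : hausdorff_space manifold_space;
  manifold_second_countable : @second_countable manifold_space;
  atlas : set (chart R n manifold_space);
  atlas_cover : forall p, exists2 c, atlas c & chart_dom c p;
  atlas_compatible : forall c d, atlas c -> atlas d ->
    smooth_on (c @` (chart_dom c `&` chart_dom d)) (d \o chart_inv c) }.

Definition smooth_map (R : realType) (m n : nat) (M : smoothManifold R m)
    (N : smoothManifold R n) (F : M -> N) : Prop :=
  continuous F /\
  forall c d, atlas c -> atlas d ->
    smooth_on (c @` (chart_dom c `&` F @^-1` chart_dom d))
              (d \o F \o chart_inv c).

Definition diffeomorphism (R : realType) (m n : nat) (M : smoothManifold R m)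
    (N : smoothManifold R n) (F : M -> N) : Prop :=
  exists F' : N -> M,
    [/\ cancel F F', cancel F' F, smooth_map F & smooth_map F'].

Section VectorSpaceManifold.
Variable R : realType.

Lemma second_countable_rV n : @second_countable 'rV[R]_n.
Proof.
pose B (qk : 'rV[rat]_n * nat) : set 'rV[R]_n :=
  ball (map_mx ratr qk.1 : 'rV[R]_n) qk.2.+1%:R^-1.
exists (range B); first exact: card_le_trans (card_image_le _ _) (countableP _).
split=> [_ [qk _ <-]|x A /nbhs_ballP[e /= e0 xeA]].
  by apply: ball_open; rewrite invr_gt0.
have [k ke] : exists k, (k.+1%:R^-1 : R) < e / 2.
  by have [N _ /(_ N (leqnn N))] := near_infty_natSinv_lt (PosNum (divr_gt0 e0 (ltr0Sn R 1))); exists N.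
have qP i j : {q : rat | ball (x i j) k.+1%:R^-1 (ratr q : R)}.
  apply/cid; have [] := @dense_rat R (ball (x i j) k.+1%:R^-1).
  - by exists (x i j); apply: ballxx; rewrite invr_gt0.
  - by apply: ball_open; rewrite invr_gt0.
  - by move=> _ [/[swap]] [q _ <-] xq; exists q.
pose q := \matrix_(i, j) sval (qP i j).
have xq : ball x k.+1%:R^-1 (map_mx ratr q : 'rV[R]_n).
  split; first by rewrite invr_gt0.
  by move=> i j; rewrite !mxE; exact: (svalP (qP i j)).
exists (B (q, k)); first by split; [exists (q, k)|apply: ball_sym].
move=> y qy; apply: xeA; rewrite [e]splitr.
by apply: (ball_triangle (le_ball (ltW ke) xq)); apply: le_ball qy; exact: ltW.
Qed.

Lemma smooth_on_id (V : normedModType R) (U : set V) : smooth_on U id.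
Proof.
have Ckcst k (w : V) : Ck_on k U (cst w).
  elim: k w => [|k IH] w /=; first by move=> x _; exact: (@cst_continuous _ _ w).
  split=> [x _|v]; first exact: differentiable_cst.
  have -> : 'D_v (cst w : V -> V) = cst 0 by apply/funext=> x; exact: derive_cst.
  exact: IH.
case=> [|k] /=; first by move=> x _; exact: cvg_id.
split=> [x _|v]; first exact: ex_diff.
have -> : 'D_v (id : V -> V) = cst v by apply/funext=> x; exact: derive_id.
exact: Ckcst.
Qed.

Variable V : vectType R.

(* The topology and the smooth structure of a finite-dimensional real vector
   space are transported along v2r, a linear isomorphism from V onto R^(dim V);
   they do not depend on the choice of that isomorphism. *)
Definition vect_space : topologicalType :=
  initial_topology (v2r : V -> 'rV[R]_(dim V)).

Lemma v2r_continuous : continuous (v2r : vect_space -> 'rV[R]_(dim V)).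
Proof. exact: initial_continuous. Qed.

Lemma vect_space_hausdorff : hausdorff_space vect_space.
Proof.
move=> x y xy; apply: (@v2r_inj _ V); apply: norm_hausdorff => A B Ax By.
have [z [Az Bz]] := xy _ _ (v2r_continuous Ax) (v2r_continuous By).
by exists (v2r (z : V)).
Qed.

Lemma vect_space_second_countable : @second_countable vect_space.
Proof.
have [B cB [Bo Bb]] := second_countable_rV (dim V).
exists [set (v2r : vect_space -> 'rV[R]_(dim V)) @^-1` A | A in B].
  exact: card_le_trans (card_image_le _ _) cB.
split=> [_ [A BA <-]|x A [_ [[C Co <-] Cx CA]]].
  by exists A => //; exact: Bo.
have [D [BD Dx] DC] := Bb (v2r (x : V)) C (open_nbhs_nbhs (conj Co Cx)).
exists (v2r @^-1` D); first by split => //; exists D.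
by move=> y /DC; exact: CA.
Qed.

Lemma r2v_continuous : continuous (r2v : 'rV[R]_(dim V) -> vect_space).
Proof.
apply/continuousP => _ [A Ao <-].
suff -> : r2v @^-1` (v2r @^-1` A) = A by [].
by apply/funext=> x /=; rewrite /preimage/= r2vK.
Qed.

Definition vect_chart : chart R (dim V) vect_space :=
  @Chart R (dim V) vect_space setT setT v2r r2v openT openT
    (fun _ _ => I) (fun _ _ => I) (in1W (@v2rK _ V)) (in1W (@r2vK _ V))
    (in1W v2r_continuous) (in1W r2v_continuous).

Lemma vect_atlas_cover p :
  exists2 c, [set vect_chart] c & chart_dom c p.
Proof. by exists vect_chart. Qed.

Lemma vect_atlas_compatible c d : [set vect_chart] c -> [set vect_chart] d ->
  smooth_on (c @` (chart_dom c `&` chart_dom d)) (d \o chart_inv c).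
Proof.
move=> -> ->.
have -> : vect_chart \o chart_inv vect_chart = id.
  by apply/funext => x; exact: r2vK.
exact: smooth_on_id.
Qed.

Definition vect_manifold : smoothManifold R (dim V) :=
  SmoothManifold vect_space_hausdorff vect_space_second_countable
    vect_atlas_cover vect_atlas_compatible.
End VectorSpaceManifold.

(* Tangent vectors are equivalence classes of smooth curves. *)
Section TangentSpace.
Variables (R : realType) (n : nat) (M : smoothManifold R n).
Implicit Types g h : R -> M.

Definition smooth_curve g : Prop :=
  continuous g /\
  forall c, atlas c -> smooth_on (g @^-1` chart_dom c) (c \o g).

Definition same_velocity g h : Prop :=
  g 0 = h 0 /\
  forall c, atlas c -> chart_dom c (g 0) -> derive1 (c \o g) 0 = derive1 (c \o h) 0.

Definition velocity g : set (R -> M) :=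
  [set h | smooth_curve h /\ same_velocity g h].

Definition tangent_space (p : M) : set (set (R -> M)) :=
  [set velocity g | g in [set g | smooth_curve g /\ g 0 = p]].
End TangentSpace.

(* The differential of a smooth map F, [g] |-> [F \o g]. All the terms of the
   union are equal when X is a tangent vector. *)
Definition differential (R : realType) (m n : nat) (M : smoothManifold R m)
    (N : smoothManifold R n) (F : M -> N) (X : set (R -> M)) : set (R -> N) :=
  \bigcup_(g in X) velocity (F \o g).

(* The canonical identification of the tangent spaces of V with V,
   [g] |-> g'(0); the derivative is computed in the linear coordinates v2r and
   is the same for all g in a tangent vector X. *)
Definition vect_tangent (R : realType) (V : vectType R)
    (X : set (R -> vect_manifold V)) : V :=
  r2v (xget 0 [set derive1 (v2r \o (g : R -> V)) 0 | g in X]).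

Record logEuclideanLieGroup (R : realType) (n : nat) := LogEuclideanLieGroup {
  leManifold :> smoothManifold R n;
  lieAlgebra : vectType R;
  leLog : leManifold -> vect_manifold lieAlgebra;
  leExp : vect_manifold lieAlgebra -> leManifold;
  leLogK : cancel leLog leExp;
  leExpK : cancel leExp leLog;
  leLog_smooth : smooth_map leLog;
  leExp_smooth : smooth_map leExp }.

Definition leMul (R : realType) (n : nat) (G : logEuclideanLieGroup R n)
    (u v : G) : G :=
  leExp ((leLog u : lieAlgebra G) + (leLog v : lieAlgebra G)).

Definition leOne (R : realType) (n : nat) (G : logEuclideanLieGroup R n) : G :=
  leExp (0 : lieAlgebra G).

Definition lie_group_isomorphism (R : realType) (m n : nat)
    (G : logEuclideanLieGroup R m) (H : logEuclideanLieGroup R n)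
    (F : G -> H) : Prop :=
  {morph F : u v / leMul u v >-> leMul u v} /\ diffeomorphism F.

(* For X tangent at the identity, this is the identification of the tangent
   space at the identity with the Lie algebra through the differential of log. *)
Definition lie_coord (R : realType) (n : nat) (G : logEuclideanLieGroup R n)
    (X : set (R -> G)) : lieAlgebra G :=
  vect_tangent (differential (@leLog R n G) X).

(* The differential of F at the identity, regarded as a map between the Lie
   algebras, is psi. *)
Definition differential_at_one_is (R : realType) (m n : nat)
    (G : logEuclideanLieGroup R m) (H : logEuclideanLieGroup R n)
    (F : G -> H) (psi : lieAlgebra G -> lieAlgebra H) : Prop :=
  forall X, tangent_space (leOne G) X ->
    lie_coord (differential F X) = psi (lie_coord X).

(* Main.v *)
(* A morphism F, read in logarithmic coordinates, is an additive map
   L = log_H o F o exp_G between the Lie algebras, and the differential of F at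
   the identity applied to v is the derivative at 0 of t |-> L (t v).  By
   additivity n L (v/n) = L v for all n, so that derivative is L v: a
   smooth morphism is determined by its differential at the identity.  Existence
   rests on linear maps being smooth and on the C^k chain rule in charts. *)
From HB Require Import structures.
Require Import Defs.
From mathcomp Require Import all_boot all_order all_algebra.
From mathcomp Require Import all_classical all_reals all_analysis.

Set Implicit Arguments.
Unset Strict Implicit.
Unset Printing Implicit Defensive.

Import Order.TTheory GRing.Theory Num.Theory.
Import numFieldNormedType.Exports.
Import VectorInternalTheory.

Local Open Scope classical_set_scope.
Local Open Scope ring_scope.

(** * Differentials: locality, product rule, chain rule *)

Section Differentiability.
Variable R : realType.
Implicit Types V W Z : normedModType R.

(** The little-o expansion at [x] sees only the germ of the map, so ['d f x] also expands [g];
    uniqueness of the differential concludes. *)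
Lemma near_eq_diff V W (f g : V -> W) (x : V) :
  {near x, f =1 g} -> differentiable f x ->
  differentiable g x /\ 'd g x = 'd f x :> (V -> W).
Proof.
move=> fg df.
have E : g \o shift x = cst (g x) + 'd f x +o_ 0 id.
  apply/eqaddoP => e e0.
  have /eqaddoP/(_ e e0) H := diff_locally df.
  move: (fg); rewrite {1}(near_shift (0 : V)) subr0 => fg0.
  have fgx : f x = g x by exact: (nbhs_singleton fg).
  near=> h.
  have fgh : (f \o shift x) h = (g \o shift x) h by near: h.
  have : `|(f \o shift x - (cst (f x) + 'd f x)) h| <= e * `|h| by near: h; exact: H.
  by rewrite !fctE/= -fgx; move: fgh => /= ->.
have gd : 'd g x = 'd f x :> (V -> W).
  by apply: diff_unique => //; exact: diff_continuous.
split=> //; apply/diff_locallyP; rewrite gd; split=> //.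
exact: diff_continuous.
Unshelve. all: by end_near. Qed.

Lemma scale_is_bilinear Z : bilinear_for
  (GRing.Scale.Law.clone _ _ *:%R _) (GRing.Scale.Law.clone _ _ *:%R _)
  (fun (a : R) (z : Z) => a *: z).
Proof.
split=> [z|a] k x y /=; first by rewrite scalerDl scalerA.
by rewrite scalerDr !scalerA mulrC.
Qed.

Lemma differentiable_scale V Z (a : V -> R) (b : V -> Z) x :
  differentiable a x -> differentiable b x ->
  differentiable (fun y => a y *: b y) x /\
  forall v, 'd (fun y => a y *: b y) x v = a x *: 'd b x v + 'd a x v *: b x.
Proof.
move=> da db.
(* Scaling is packed as a bilinear map [B]; the product rule is then the chain rule for [B] after
   the pairing of [a] and [b]. *)
pose BM := bilinear_isBilinear.Build R R Z Z _ _ (fun (a : R) (z : Z) => a *: z)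
  (@scale_is_bilinear Z).
pose B : {bilinear R -> Z -> Z} := HB.pack (fun (a : R) (z : Z) => a *: z) BM.
have Bc : continuous (fun p : R * Z => B p.1 p.2) by exact: scale_continuous.
have dp := differentiable_pair da db.
have -> : (fun y => a y *: b y) = (fun p : R * Z => B p.1 p.2) \o (fun y => (a y, b y)) by [].
split=> [|v].
  by apply: differentiable_comp => //; exact: (differentiable_bilin (f:=B)).
rewrite diff_comp//; last exact: (differentiable_bilin (f:=B)).
rewrite (@diff_bilin _ _ _ _ B)// diff_pair//.
Qed.

Lemma derive_comp V W Z (f : V -> W) (g : W -> Z) x v :
  differentiable f x -> differentiable g (f x) ->
  'D_v (g \o f) x = 'D_('D_v f x) g (f x).
Proof.
move=> df dg; rewrite !deriveE//; last exact: differentiable_comp.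
by rewrite diff_comp.
Qed.
End Differentiability.

(** * Calculus of C^k maps *)

Section ContinuouslyDifferentiable.
Variable R : realType.
Implicit Types V W Z : normedModType R.

Lemma CkW k V W (U : set V) (f : V -> W) : Ck_on k.+1 U f -> Ck_on k U f.
Proof.
elim: k f => [|k IH] f [df Df].
  by move=> x /set_mem Ux; exact/differentiable_continuous/df.
by split=> // v; exact/IH/Df.
Qed.

(** Each clause of [Ck_on] constrains the total map [f] at single points of the set, so any set
    containing the point can serve as [A]. *)
Lemma Ck_local k V W (U : set V) (f : V -> W) :
  (forall x, U x -> exists2 A, A x & Ck_on k A f) -> Ck_on k U f.
Proof.
elim: k f => [|k IH] f H.
  by move=> x /set_mem /H[A Ax cf]; exact/cf/mem_set.
split=> [x /H[A Ax [df _]]|v]; first exact: df.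
by apply: IH => x /H[A Ax [_ Df]]; exists A => //; exact: Df.
Qed.

Lemma sub_Ck k V W (U A : set V) (f : V -> W) :
  A `<=` U -> Ck_on k U f -> Ck_on k A f.
Proof. by move=> AU Uf; apply: Ck_local => x Ax; exists U => //; exact: AU. Qed.

(** On an open set, agreement on [U] is agreement near each point, which derivatives respect. The
    inductions below use this to replace a directional derivative by its formula on [U]. *)
Lemma eq_Ck k V W (U : set V) (f g : V -> W) : open U ->
  {in U, f =1 g} -> Ck_on k U f -> Ck_on k U g.
Proof.
move=> oU.
have near_fg (f' g' : V -> W) x : {in U, f' =1 g'} -> U x -> {near x, f' =1 g'}.
  move=> fg Ux; apply: filterS (open_nbhs_nbhs (conj oU Ux)) => y Uy.
  exact/fg/mem_set.
elim: k f g => [|k IH] f g fg.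
  move=> cf x xU; rewrite /continuous_at -(fg x xU).
  by apply: cvg_trans (cf x xU); exact/near_eq_cvg/near_fg/set_mem.
move=> [df Df]; have fgx := near_fg f g _ fg.
split=> [x Ux|v]; first exact: (near_eq_diff (fgx x Ux) (df x Ux)).1.
by apply: IH (Df v) => x /set_mem /fgx; exact: near_eq_derive.
Qed.

Lemma Ck_cst k V W (U : set V) (w : W) : Ck_on k U (fun _ : V => w).
Proof.
elim: k w => [|k IH] w /=; first by move=> x _; exact: (@cst_continuous _ _ w).
split=> [x _|v]; first exact: differentiable_cst.
have -> : 'D_v (cst w : V -> W) = cst 0 by apply/funext=> x; exact: derive_cst.
exact: IH.
Qed.

Lemma CkD k V W (U : set V) (f g : V -> W) : open U ->
  Ck_on k U f -> Ck_on k U g -> Ck_on k U (fun x => f x + g x).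
Proof.
move=> oU; elim: k f g => [|k IH] f g.
  by move=> cf cg x Ux; apply: continuousD; [exact: cf|exact: cg].
move=> [df Df] [dg Dg]; split=> [x Ux|v].
  by apply: differentiableD; [exact: df|exact: dg].
apply: eq_Ck (IH _ _ (Df v) (Dg v)) => // x /set_mem Ux.
by rewrite deriveD//; apply: diff_derivable; [exact: df|exact: dg].
Qed.

Lemma Ck_sum k V W (U : set V) m (f : 'I_m -> V -> W) : open U ->
  (forall i, Ck_on k U (f i)) -> Ck_on k U (fun x => \sum_(i < m) f i x).
Proof.
move=> oU; elim: m f => [|m IH] f Uf.
  apply: eq_Ck (Ck_cst k U 0) => // x _; by rewrite big_ord0.
have := CkD oU (IH _ (fun i => Uf (widen_ord (leqnSn m) i))) (Uf ord_max).
by apply: eq_Ck => // x _; rewrite big_ord_recr.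
Qed.

Lemma Ck_scale k V W (U : set V) (a : V -> R) (f : V -> W) : open U ->
  Ck_on k U a -> Ck_on k U f -> Ck_on k U (fun x => a x *: f x).
Proof.
move=> oU; elim: k a f => [|k IH] a f.
  by move=> ca cf x Ux; apply: continuousZ; [exact: ca|exact: cf].
move=> Ca Cf; have [da Da] := Ca; have [df Df] := Cf; split=> [x Ux|v].
  by apply: (differentiable_scale _ _).1; [exact: da|exact: df].
(* The two Leibniz terms; [CkW] lowers the undifferentiated factor from C^(k+1) to C^k. *)
have := CkD oU (IH _ _ (CkW Ca) (Df v)) (IH _ _ (Da v) (CkW Cf)).
apply: eq_Ck => // x /set_mem Ux; have [dax dfx] := (da x Ux, df x Ux).
have [dz zE] := differentiable_scale dax dfx.
by rewrite !deriveE.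
Qed.

(** Induction on [k], since [L] commutes with directional derivatives: ['D_v (L \o f) = L \o 'D_v f]
    on [U]. *)
Lemma Ck_linear k V W Z (U : set V) (L : {linear W -> Z}) (f : V -> W) :
  open U -> continuous L -> Ck_on k U f -> Ck_on k U (L \o f).
Proof.
move=> oU cL; elim: k f => [|k IH] f.
  by move=> cf x Ux; apply: continuous_comp; [exact: cf|exact: cL].
move=> [df Df]; have dL w : differentiable L w by exact: linear_differentiable.
split=> [x Ux|v]; first by apply: differentiable_comp; [exact: df|].
apply: eq_Ck (IH _ (Df v)) => // x /set_mem Ux.
rewrite derive_comp //; last exact: df.
by rewrite [RHS](deriveE _ (dL _)) (diff_lin _ cL).
Qed.

Lemma Ck_coord k V m (U : set V) (f : V -> 'rV[R]_m) i : open U ->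
  Ck_on k U f -> Ck_on k U (fun x => f x 0 i).
Proof.
move=> oU.
have lin : linear (fun u : 'rV[R]_m => u 0 i : R) by move=> c u v; rewrite !mxE.
pose LM := GRing.isLinear.Build _ _ _ _ _ lin.
pose L : {linear 'rV[R]_m -> R} := HB.pack (fun u : 'rV[R]_m => u 0 i : R) LM.
apply: (@Ck_linear k V 'rV[R]_m R U L f oU).
exact: coord_continuous.
Qed.

(* Expanding the chain rule [D_v (g \o f) x = 'd g (f x) (D_v f x)] in the
   standard basis expresses it through the partial derivatives of [g], which
   are C^k when [g] is C^(k+1). *)
Lemma Ck_comp k V m Z (U : set V) (A : set 'rV[R]_m)
    (f : V -> 'rV[R]_m) (g : 'rV[R]_m -> Z) : open U -> set_fun U A f ->
  Ck_on k U f -> Ck_on k A g -> Ck_on k U (g \o f).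
Proof.
move=> oU UA; elim: k g => [|k IH] g.
  move=> cf cg x /set_mem Ux.
  by apply: continuous_comp; [exact/cf/mem_set|exact/cg/mem_set/UA].
move=> Cf [dg Dg]; have [df Df] := Cf; split=> [x Ux|v].
  by apply: differentiable_comp; [exact: df|exact/dg/UA].
have C i : Ck_on k U (fun x => 'D_v f x 0 i *: ('D_(delta_mx 0 i) g \o f) x).
  apply: Ck_scale => //; first exact: (Ck_coord i oU (Df v)).
  by apply: IH (Dg _); exact: CkW.
apply: eq_Ck (Ck_sum oU C) => // x /set_mem Ux.
have dgx := dg _ (UA _ Ux); rewrite (derive_comp v (df _ Ux) dgx).
rewrite [RHS]deriveE// [in RHS](row_sum_delta (derive f x v)) linear_sum.
by apply: eq_bigr => i _; rewrite linearZ /= (deriveE _ dgx).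
Qed.

Lemma linear_rV_continuous m Z (L : {linear 'rV[R]_m -> Z}) : continuous L.
Proof.
have -> : L = (fun u : 'rV[R]_m => \sum_(i < m) u 0 i *: L (delta_mx 0 i)) :> (_ -> _).
  apply/funext=> u; rewrite {1}(row_sum_delta u) linear_sum.
  by apply: eq_bigr => i _; rewrite linearZ.
apply: continuous_big => [|i _ u]; first exact: add_continuous.
apply: (@continuous_comp _ _ _ (fun u : 'rV[R]_m => u 0 i : R)
  ( *:%R^~ (L (delta_mx 0 i)))); first exact: coord_continuous.
exact: scalel_continuous.
Qed.

Lemma smooth_linear_rV m Z (U : set 'rV[R]_m) (L : {linear 'rV[R]_m -> Z}) :
  smooth_on U L.
Proof.
move=> k; apply: (@sub_Ck _ _ _ setT) => //.
apply: (@Ck_linear k _ _ _ setT L id) openT _ _.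
  exact: linear_rV_continuous.
exact: smooth_on_id.
Qed.

End ContinuouslyDifferentiable.

(** * Smooth maps and curves on manifolds *)

Section SmoothMaps.
Variable R : realType.

Lemma open_setI_preimage (T S : topologicalType) (U : set T) (A : set S)
    (f : T -> S) : open U -> {in U, continuous f} -> open A ->
  open (U `&` f @^-1` A).
Proof.
move=> oU cf oA; rewrite openE => x [Ux Afx]; apply: filterI.
  exact: open_nbhs_nbhs.
by apply: (cf x (mem_set Ux)); exact: open_nbhs_nbhs.
Qed.

(** Turns the domains occurring in [smooth_map] into the preimage form used by [smooth_into]. *)
Lemma chart_imageE n (M : topologicalType) (c : chart R n M) (B : set M) :
  c @` (chart_dom c `&` B) = chart_cod c `&` chart_inv c @^-1` B.
Proof.
apply/seteqP; split=> [_ [p [cp Bp] <-]|x [cx Bx]].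
  by split; [exact: chart_map_fun|rewrite /preimage/= chart_mapK ?inE].
exists (chart_inv c x); last by rewrite chart_invK ?inE.
by split=> //; exact: chart_inv_fun.
Qed.

(* Covers both the smooth curves ([V = R], [U = setT]) and the smooth maps read
   in a chart of the source manifold ([V = 'rV_m], [U = chart_cod c]). *)
Definition smooth_into (V : normedModType R) (U : set V) n
    (M : smoothManifold R n) (g : V -> M) : Prop :=
  {in U, continuous g} /\
  forall c : chart R n M, atlas c ->
    smooth_on (U `&` g @^-1` chart_dom c) (c \o g).

(** Smoothness is local: around [x], a chart [c] of [M] at [g x] factors [d \o F \o g] as
    [(d \o F \o chart_inv c) \o (c \o g)], to which the C^k chain rule applies. *)
Lemma smooth_into_comp (V : normedModType R) (U : set V) m n
    (M : smoothManifold R m) (N : smoothManifold R n) (g : V -> M) (F : M -> N) :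
  open U -> smooth_into U g -> smooth_map F -> smooth_into U (F \o g).
Proof.
move=> oU [cg sg] [cF sF]; split=> [x Ux|d Nd k].
  by apply: continuous_comp; [exact: cg|exact: cF].
apply: Ck_local => x [Ux dx]; have [c Mc cx] := atlas_cover (g x).
pose B := chart_dom c `&` F @^-1` chart_dom d.
have oB : open B.
  apply: open_setI_preimage; [exact: chart_dom_open| |exact: chart_dom_open].
  by move=> y _; exact: cF.
exists (U `&` g @^-1` B) => //.
have oUB : open (U `&` g @^-1` B) by exact: open_setI_preimage.
apply: (@eq_Ck _ _ _ _ _ ((d \o F \o chart_inv c) \o (c \o g))) => //.
  by move=> y /set_mem [_ [cy _]]; rewrite /= chart_mapK ?inE.
apply: (Ck_comp oUB _ _ (sF c d Mc Nd k)); first by move=> y [_ By]; exists (g y).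
by apply: sub_Ck (sg c Mc k) => y [Uy [cy _]].
Qed.

Lemma smooth_mapP m n (M : smoothManifold R m) (N : smoothManifold R n)
    (F : M -> N) : smooth_map F <-> continuous F /\
  forall c : chart R m M, atlas c -> smooth_into (chart_cod c) (F \o chart_inv c).
Proof.
split=> [[cF sF]|[cF sF]]; split=> // c.
  move=> Mc; split=> [x cx|d Nd].
    by apply: continuous_comp; [exact: chart_inv_continuous|exact: cF].
  by have := sF c d Mc Nd; rewrite chart_imageE.
by move=> d Mc Nd; rewrite chart_imageE; exact: (sF c Mc).2.
Qed.

Lemma smooth_map_comp l m n (L : smoothManifold R l) (M : smoothManifold R m)
    (N : smoothManifold R n) (F : L -> M) (G : M -> N) :
  smooth_map F -> smooth_map G -> smooth_map (G \o F).
Proof.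
move=> /smooth_mapP[cF sF] sG; apply/smooth_mapP; split=> [x|c Lc].
  by apply: continuous_comp; [exact: cF|exact: sG.1].
exact: (smooth_into_comp (@chart_cod_open _ _ _ c) (sF c Lc) sG).
Qed.

Lemma smooth_curveP n (M : smoothManifold R n) (g : R -> M) :
  smooth_curve g <-> smooth_into setT g.
Proof.
split=> -[cg sg]; split.
- by move=> x _; exact: cg.
- by move=> c Mc; rewrite setTI; exact: sg.
- by move=> x; apply: cg; rewrite inE.
- by move=> c Mc; have := sg c Mc; rewrite setTI.
Qed.

Lemma smooth_curve_comp m n (M : smoothManifold R m) (N : smoothManifold R n)
    (F : M -> N) (g : R -> M) :
  smooth_map F -> smooth_curve g -> smooth_curve (F \o g).
Proof.
move=> sF /smooth_curveP sg; apply/smooth_curveP.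
exact: (smooth_into_comp openT sg sF).
Qed.

(** The expression of [L] in the global charts of [vect_manifold]; on row vectors the standard basis
    is available. *)
Definition coord_linear (V W : vectType R) (L : {linear V -> W}) :
  'rV[R]_(dim V) -> 'rV[R]_(dim W) := v2r \o L \o r2v.

Fact coord_linear_is_linear (V W : vectType R) (L : {linear V -> W}) :
  linear (coord_linear L).
Proof. by move=> a u v; rewrite /coord_linear/= !linearP. Qed.

HB.instance Definition _ (V W : vectType R) (L : {linear V -> W}) :=
  GRing.isLinear.Build _ _ _ _ (coord_linear L) (@coord_linear_is_linear V W L).

Lemma smooth_linear (V W : vectType R) (L : {linear V -> W}) :
  @smooth_map R _ _ (vect_manifold V) (vect_manifold W) L.
Proof.
split=> [|c d -> ->]; last exact: smooth_linear_rV (coord_linear L).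
have -> : L = r2v \o coord_linear L \o v2r :> (vect_manifold V -> vect_manifold W).
  by apply/funext=> x; rewrite /coord_linear/= !v2rK.
move=> x; apply: continuous_comp; first exact: v2r_continuous.
by apply: continuous_comp; [exact: linear_rV_continuous|exact: r2v_continuous].
Qed.

(** Lines, pushed forward by [leExp], provide the one-parameter subgroups used for uniqueness. *)
Lemma smooth_line (V : vectType R) (v : V) :
  smooth_curve (fun t : R => t *: v : vect_manifold V).
Proof.
have lE : v2r \o (fun t : R => t *: v) = *:%R^~ (v2r v).
  by apply/funext=> t; rewrite /= linearZ.
split=> [t|c -> k].
  have -> : (fun t : R => t *: v : vect_manifold V) = r2v \o *:%R^~ (v2r v).
    by rewrite -lE; apply/funext=> s; rewrite /= v2rK.
  by apply: continuous_comp; [exact: scalel_continuous|exact: r2v_continuous].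
apply: (@sub_Ck _ _ _ _ setT) => //.
change (Ck_on k setT (v2r \o (fun t : R => t *: v))); rewrite lE.
apply: (Ck_scale openT); [exact: smooth_on_id|exact: Ck_cst].
Qed.

End SmoothMaps.

(** * Tangent vectors and differentials *)

Section Velocity.
Variable R : realType.

Lemma smooth_curve_differentiable n (M : smoothManifold R n) (g : R -> M)
    (c : chart R n M) t : smooth_curve g -> atlas c -> chart_dom c (g t) ->
  differentiable (c \o g) t.
Proof. by move=> [_ sg] Mc ct; have [dg _] := sg c Mc 1%N; exact: dg. Qed.

(** By the chain rule the derivative of [d \o F \o f] at 0 depends only on [f 0] and on the
    derivative of [c \o f] in one chart [c]. Hence the differential is well defined on velocity
    classes. *)
Lemma same_velocity_comp m n (M : smoothManifold R m) (N : smoothManifold R n)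
    (F : M -> N) (g h : R -> M) : smooth_map F ->
  smooth_curve g -> smooth_curve h -> same_velocity g h ->
  same_velocity (F \o g) (F \o h).
Proof.
move=> [cF sF] sg sh [gh0 gh]; split=> [|d Nd /= dg]; first by rewrite /= gh0.
have [c Mc cg] := atlas_cover (g 0).
have chain f : smooth_curve f -> chart_dom c (f 0) -> chart_dom d (F (f 0)) ->
    derive1 (d \o (F \o f)) 0 =
    'D_(derive1 (c \o f) 0) (d \o F \o chart_inv c) (c (f 0)).
  move=> sf cf df; rewrite !derive1E.
  (* The factorization through [c] holds only near 0, while [f] stays in the chart domain. *)
  rewrite (@near_eq_derive _ _ _ _ ((d \o F \o chart_inv c) \o (c \o f))).
    apply: derive_comp; first exact: smooth_curve_differentiable.
    have [+ _] := sF c d Mc Nd 1%N; apply; by exists (f 0).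
  have : nbhs (0 : R) (f @^-1` chart_dom c).
    by apply: sf.1; apply: open_nbhs_nbhs; split=> //; exact: chart_dom_open.
  by apply: filterS => t ct; rewrite /= chart_mapK ?inE.
have [ch dh] : chart_dom c (h 0) /\ chart_dom d (F (h 0)) by rewrite -gh0.
by rewrite (chain g)// (chain h)// gh// gh0.
Qed.

Lemma eq_velocity n (M : smoothManifold R n) (g h : R -> M) :
  same_velocity g h -> velocity g = velocity h.
Proof.
move=> [gh0 gh]; apply/seteqP; split=> k [sk [k0 vk]]; split=> //.
  split=> [|c Mc ch]; first by rewrite -gh0.
  by rewrite -vk// ?gh// gh0.
split=> [|c Mc cg]; first by rewrite gh0.
by rewrite gh// vk// -gh0.
Qed.

Lemma velocity_refl n (M : smoothManifold R n) (g : R -> M) :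
  smooth_curve g -> velocity g g.
Proof. by split. Qed.

Lemma differential_velocity m n (M : smoothManifold R m)
    (N : smoothManifold R n) (F : M -> N) (g : R -> M) :
  smooth_map F -> smooth_curve g ->
  differential F (velocity g) = velocity (F \o g).
Proof.
move=> sF sg; apply/seteqP; split=> [k [h [sh gh]] vk|k vk].
  by rewrite (eq_velocity (same_velocity_comp sF sg sh gh)).
by exists g => //; exact: velocity_refl.
Qed.

Lemma vect_tangent_velocity (V : vectType R) (g : R -> vect_manifold V) :
  smooth_curve g ->
  vect_tangent (velocity g) = r2v (derive1 (v2r \o (g : R -> V)) 0).
Proof.
move=> sg; rewrite /vect_tangent; congr r2v.
(* All curves of the class have the same derivative in the chart [v2r], so the set is a singleton
   and [xget] does not fall back on its default 0. *)
apply: xget_unique => [|_ [h [_ [_ gh]] <-]].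
  by exists g => //; exact: velocity_refl.
by have := gh (vect_chart V) erefl I.
Qed.

Lemma derive1_linear_comp (V W : vectType R) (L : {linear V -> W})
    (g : R -> vect_manifold V) : smooth_curve g ->
  derive1 (v2r \o L \o (g : R -> V)) 0 =
  v2r (L (r2v (derive1 (v2r \o (g : R -> V)) 0))).
Proof.
move=> sg; have Lc := @linear_rV_continuous _ _ _ (coord_linear L).
have -> : v2r \o L \o (g : R -> V) = coord_linear L \o (v2r \o (g : R -> V)).
  by apply/funext=> t; rewrite /coord_linear/= v2rK.
have dg : differentiable (v2r \o (g : R -> V)) 0.
  by have := @smooth_curve_differentiable
    _ (vect_manifold V) g (vect_chart V) 0 sg erefl I.
have dL w := @linear_differentiable _ _ _ (coord_linear L) w Lc.
by rewrite !derive1E derive_comp// (deriveE _ (dL _)) (diff_lin _ Lc).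
Qed.

(** The derivative exists, so it can be computed along the steps 1/(n+1), where additivity makes the
    difference quotient constantly [f 1]. *)
Lemma derive1_additive (W : normedModType R) (f : R -> W) :
  {morph f : s t / s + t} -> differentiable f 0 -> derive1 f 0 = f 1.
Proof.
move=> fD df.
have f0 : f 0 = 0 by apply: (addrI (f 0)); rewrite -fD !addr0.
have fMn n t : f (t *+ n) = f t *+ n.
  by elim: n => [|n IH]; rewrite ?mulr0n// !mulrS fD IH.
have /cvg_ex[l fl] : derivable f 0 1 by exact: diff_derivable.
(* [harmonic n] is 1/(n+1), never zero, so it tends to 0 within the punctured neighbourhoods over
   which the derivative is a limit. *)
have h0 : @harmonic R n @[n --> \oo] --> 0^'.
  move=> A [e /= e0 eA]; apply: filterS (near_infty_natSinv_lt (PosNum e0)) => n ne.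
  apply: eA; last by rewrite invr_eq0 pnatr_eq0.
  by rewrite /= sub0r normrN ger0_norm ?invr_ge0.
have := cvg_comp _ _ h0 fl.
rewrite (_ : _ \o _ = cst (f 1)); last first.
  apply/funext=> n; rewrite /harmonic/= addr0 f0 subr0 invrK.
  rewrite scaler_nat -fMn; congr f.
  by rewrite [_ *: _]mulr1 -[LHS]mulr_natl divff.
move=> f1l; rewrite derive1E /derive (cvg_lim _ fl)//.
by apply: (cvg_unique _ f1l) => //; exact: cvg_cst.
Qed.

Lemma derive1_line (V : vectType R) (v : V) :
  derive1 (v2r \o (fun t : R => t *: v)) 0 = v2r v.
Proof.
have sl := smooth_line v.
rewrite derive1_additive /=; first by rewrite scale1r.
  by move=> s t; rewrite /= scalerDl linearD.
by have := @smooth_curve_differentiable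
  _ (vect_manifold V) _ (vect_chart V) 0 sl erefl I.
Qed.

End Velocity.

(** * Existence and uniqueness of the isomorphism *)

Section LieCoordinates.
Variable R : realType.

Lemma lie_coord_velocity n (G : logEuclideanLieGroup R n) (g : R -> G) :
  smooth_curve g ->
  lie_coord (velocity g) = r2v (derive1 (v2r \o (@leLog R n G \o g)) 0).
Proof.
move=> sg; have sl := @leLog_smooth R n G.
rewrite /lie_coord differential_velocity// vect_tangent_velocity//.
exact: smooth_curve_comp.
Qed.

(** The inverse has the same shape, with the inverse [phi] of [psi], which is again linear; so both
    directions are smooth for the same reason. *)
Lemma leExp_linear_leLog_isomorphism n (G H : logEuclideanLieGroup R n)
    (psi : {linear lieAlgebra G -> lieAlgebra H}) : bijective psi ->
  lie_group_isomorphism (@leExp R n H \o psi \o @leLog R n G).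
Proof.
move=> [phi psiK phiK].
have phi_linear : linear phi := can2_linear psiK phiK.
pose phiM := GRing.isLinear.Build _ _ _ _ phi phi_linear.
pose phiL : {linear lieAlgebra H -> lieAlgebra G} := HB.pack phi phiM.
split=> [u v|]; first by rewrite /leMul /= !leExpK linearD.
exists (@leExp R n G \o phi \o @leLog R n H); split=> [u|v| |].
- by rewrite /= leExpK psiK leLogK.
- by rewrite /= leExpK phiK leLogK.
- apply: smooth_map_comp; first exact: leLog_smooth.
  by apply: smooth_map_comp; [exact: smooth_linear|exact: leExp_smooth].
- apply: smooth_map_comp; first exact: leLog_smooth.
  apply: smooth_map_comp; last exact: leExp_smooth.
  exact: (smooth_linear phiL).
Qed.

(** In logarithmic coordinates the map is [psi] itself, and a linear map commutes with the
    derivative of a curve. *)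
Lemma leExp_linear_leLog_differential n (G H : logEuclideanLieGroup R n)
    (psi : {linear lieAlgebra G -> lieAlgebra H}) : bijective psi ->
  differential_at_one_is (@leExp R n H \o psi \o @leLog R n G) psi.
Proof.
move=> /leExp_linear_leLog_isomorphism[_ [_ [_ _ sPhi _]]].
move=> _ [g [sg _] <-].
rewrite differential_velocity// !lie_coord_velocity//; last exact: smooth_curve_comp.
have sl : smooth_curve (@leLog R n G \o g).
  by apply: smooth_curve_comp sg; exact: leLog_smooth.
rewrite -[RHS]v2rK -(derive1_linear_comp psi sl); congr (r2v (derive1 _ 0)).
by apply/funext=> t; rewrite /= leExpK.
Qed.

Lemma isomorphism_eq_leExp_linear_leLog n (G H : logEuclideanLieGroup R n)
    (psi : {linear lieAlgebra G -> lieAlgebra H}) (F : G -> H) :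
  lie_group_isomorphism F -> differential_at_one_is F psi ->
  F = @leExp R n H \o psi \o @leLog R n G.
Proof.
move=> [FM [_ [_ _ sF _]]] dF.
suff FE v : @leLog R n H (F (leExp v)) = psi v.
  by apply/funext=> u; rewrite /= -FE !leLogK.
(* The image under [F] of the one-parameter subgroup of direction [v], in linear coordinates; [F]
   being a morphism makes [f] additive. *)
pose f t : 'rV[R]_(dim (lieAlgebra H)) := v2r (@leLog R n H (F (leExp (t *: v)))).
have fD : {morph f : s t / s + t}.
  move=> s t; rewrite /f scalerDl -linearD; congr v2r.
  have := FM (leExp (s *: v)) (leExp (t *: v)).
  by rewrite /leMul !leExpK => ->; rewrite leExpK.
pose g (t : R) : G := leExp (t *: v : vect_manifold (lieAlgebra G)).
have sg : smooth_curve g.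
  by apply: (smooth_curve_comp (@leExp_smooth R n G)); exact: smooth_line.
have sFg : smooth_curve (F \o g) by exact: smooth_curve_comp.
have df : differentiable f 0.
  have sk := smooth_curve_comp (@leLog_smooth R n H) sFg.
  by have := @smooth_curve_differentiable
    R _ (vect_manifold (lieAlgebra H)) _ (vect_chart (lieAlgebra H)) 0 sk erefl I.
have lgE : @leLog R n G \o g = fun t : R => t *: v.
  by apply/funext=> t; rewrite /= leExpK.
have : tangent_space (leOne G) (velocity g).
  by exists g => //; split=> //; rewrite /g scale0r.
(* The class of [g] has Lie coordinate [v], so the hypothesis on the differential reads f'(0) = psi
   v in coordinates, while additivity gives f'(0) = f(1). *)
move=> /dF; rewrite differential_velocity// !lie_coord_velocity// lgE derive1_line.
have -> : v2r \o (@leLog R n H \o (F \o g)) = f by [].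
by rewrite derive1_additive// /f scale1r !v2rK.
Qed.

End LieCoordinates.

Theorem theorem3p1 (R : realType) (n : nat) (G H : logEuclideanLieGroup R n)
    (psi : {linear lieAlgebra G -> lieAlgebra H}) (psi_iso : bijective psi) :
  let Phi : G -> H := @leExp R n H \o psi \o @leLog R n G in
  [/\ lie_group_isomorphism Phi, differential_at_one_is Phi psi &
      forall F : G -> H,
        lie_group_isomorphism F -> differential_at_one_is F psi -> F = Phi].
Proof.
split; first exact: leExp_linear_leLog_isomorphism.
- exact: leExp_linear_leLog_differential.
- exact: isomorphism_eq_leExp_linear_leLog.
Qed.
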